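(* Let $X$ be a Hausdorff space, let $\tau^c$ be the family of all closed subsets of $X$ and $\mathcal S_X=\{\{x\}:x\in X\}$. Let $Y$ be a Hausdorff space with a strictly increasing closed cover $\{B_n\}_{n\in\mathbb N}$. The following are equivalent. (a) $X$ is ultrametrizable. (b) There exists a map $\phi:\tau^c\to\mathcal L(X,\mathcal F(Y))$, $F\mapsto\phi_F$ (with $\phi_x:=\phi_{\{x\}}$), such that: $F=\bigcap_{n\in\mathbb N}\phi_F^{-1}[Y\setminus B_n]$ for each $F\in\tau^c$; if $F_1,F_2\in\tau^c$ and $F_1\subset F_2$, then $\phi_{F_1}(x)\subset\phi_{F_2}(x)$ for all $x\in X$; $\phi_x(y)=\phi_y(x)$ for all $x,y\in X$; and for all $x,y,z\in X$, $\phi_x(y)\subset\phi_x(z)$ or $\phi_y(z)\subset\phi_x(z)$. (c) There exists a map $\phi:\mathcal S_X\to\mathcal L(X,\mathcal F(Y))$, $\{x\}\mapsto\phi_x$, such that: $\{x\}=\bigcap_{n\in\mathbb N}\phi_x^{-1}[Y\setminus B_n]$ for each $x\in X$; for each $x\in X$ and $F\in\tau^c$ with $x\notin F$, $\phi_x$ is bounded on $F$; $\phi_x(y)=\phi_y(x)$ for all $x,y\in X$; and for all $x,y,z\in X$, $\phi_x(y)\subset\phi_x(z)$ or $\phi_y(z)\subset\phi_x(z)$.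
   Context: $\mathbb N$ is the set of positive integers. A sequence $\{B_n\}_{n\in\mathbb N}$ of closed subsets of a space $Y$ is a strictly increasing closed cover of $Y$ if $Y=\bigcup_{n}B_n$, $B_1\neq\emptyset$ and $B_n\subsetneq B_{n+1}$ for each $n$. $\mathcal F(Y)$ is the family of nonempty closed subsets of $Y$. For a set-valued map $\psi:X\to\mathcal F(Y)$ and $B\subset Y$, $\psi^{-1}[B]=\{x\in X:\psi(x)\cap B\neq\emptyset\}$ and $\psi^{\#}[B]=\{x\in X:\psi(x)\subset B\}$. $\psi$ is lower semi-continuous if $\psi^{-1}[V]$ is open in $X$ for each open $V\subset Y$; $\mathcal L(X,\mathcal F(Y))$ is the set of all lower semi-continuous maps $X\to\mathcal F(Y)$. $\psi$ is bounded on $A\subset X$ if $A\subset\psi^{\#}[B_n]$ for some $n\in\mathbb N$. A space $X$ is ultrametrizable if there is a metric $d$ on $X$ inducing its topology such that $d(x,z)\le\max\{d(x,y),d(y,z)\}$ for all $x,y,z\in X$. *)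

(* Defs.v *)
From HB Require Import structures.
From mathcomp Require Import all_boot all_order all_algebra.
From mathcomp Require Import all_classical all_reals all_analysis.

Set Implicit Arguments.
Unset Strict Implicit.
Unset Printing Implicit Defensive.

Import Order.TTheory GRing.Theory Num.Theory.

Local Open Scope classical_set_scope.
Local Open Scope ring_scope.

Definition is_metric (R : realType) (X : Type) (d : X -> X -> R) : Prop :=
  [/\ forall x y, 0 <= d x y,
      forall x y, d x y = 0 <-> x = y,
      forall x y, d x y = d y x &
      forall x y z, d x z <= d x y + d y z].

Definition induces_topology (R : realType) (X : topologicalType)
    (d : X -> X -> R) : Prop :=
  forall A : set X, open A <->
    forall x, A x -> exists2 e : R, 0 < e & [set y | d x y < e] `<=` A.

Definition ultrametrizable (R : realType) (X : topologicalType) : Prop :=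
  exists d : X -> X -> R,
    [/\ is_metric d, induces_topology d &
        forall x y z, d x z <= Num.max (d x y) (d y z)].

(* Covers are indexed from 0: [B n] stands for the (n+1)-st set of a cover
   indexed by the positive integers. *)
Definition strictly_increasing_closed_cover (Y : topologicalType)
    (B : nat -> set Y) : Prop :=
  [/\ forall n, closed (B n),
      [set: Y] = \bigcup_n B n,
      B 0%N !=set0 &
      forall n, B n `<` B n.+1].

Definition closed_sets (X : topologicalType) : set (set X) :=
  [set F | closed F].

Definition singleton_sets (X : Type) : set (set X) :=
  [set [set x] | x in [set: X]].

Definition nonempty_closed_sets (Y : topologicalType) : set (set Y) :=
  [set F | closed F /\ F !=set0].

(* psi^{-1}[B] *)
Definition lower_inverse (X Y : Type) (psi : X -> set Y) (B : set Y) : set X :=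
  [set x | psi x `&` B !=set0].

(* psi^{#}[B] *)
Definition upper_inverse (X Y : Type) (psi : X -> set Y) (B : set Y) : set X :=
  [set x | psi x `<=` B].

Definition lower_semi_continuous (X Y : topologicalType)
    (psi : X -> set Y) : Prop :=
  forall V : set Y, open V -> open (lower_inverse psi V).

Definition lsc_maps (X Y : topologicalType) : set (X -> set Y) :=
  [set psi | set_fun [set: X] (@nonempty_closed_sets Y) psi /\
             lower_semi_continuous psi].

Definition bounded_wrt (X Y : Type) (B : nat -> set Y) (psi : X -> set Y)
    (A : set X) : Prop :=
  exists n, A `<=` upper_inverse psi (B n).

(* Main.v *)
Require Import Defs.
From mathcomp Require Import all_boot all_order all_algebra.
From mathcomp Require Import all_classical all_reals all_analysis.

(** An ultrametric is, up to the choice of a null sequence of radii, a nested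
    sequence of equivalence relations [E n] with intersection the diagonal whose
    classes form a neighbourhood base: [E n x y] says [d x y < harmonic n].  The
    set-valued maps of (b) and (c) carry this same information, the excess of
    [phi [set x] y] over the cover playing the role of closeness: the larger the
    value, the closer [y] is to [x].

    From an ultrametric to (b), [thickening] sends [F] and [x] to the union of
    [B 0] and the [B n] with [x] within [harmonic n] of [F].  It is all of [Y]
    on [F], and a single [B n] off [F] because [F] is closed; both are closed
    sets.  It is lower semi-continuous since each [harmonic n]-neighbourhood of
    [F] is open, and the strong triangle inequality becomes the last clause of
    (b).

    From (b) to (c) the map is kept: if [x] is not in [F], then [phi F x] lies in
    some [B n], and by symmetry and monotonicity it contains [phi [set x] y] for
    every [y] in [F].

    From (c) to an ultrametric, [E n x y] is defined by
    [~ phi [set x] y `<=` B n].  The last clause of (c) is its transitivity,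
    lower semi-continuity makes its classes open, and boundedness makes them
    small; [ultrametrizable_of_nested_equivalences] concludes. *)

Import Order.TTheory GRing.Theory Num.Theory.
Local Open Scope classical_set_scope.
Local Open Scope ring_scope.

(** * Distances with values in a null sequence *)

Lemma harmonic_lt (R : realType) (m n : nat) :
  (@harmonic R m < harmonic n) = (n < m)%N.
Proof. by rewrite /harmonic /= ltf_pV2 ?posrE ?ltr0n// ltr_nat ltnS. Qed.

Lemma exists_harmonic_lt (R : realType) (e : R) :
  0 < e -> exists n, harmonic n < e.
Proof.
move=> e0; have /cvgrPdist_lt/(_ e e0)[n _ /(_ n (leqnn n))] := @cvg_harmonic R.
by rewrite sub0r normrN ger0_norm ?harmonic_ge0// => ?; exists n.
Qed.

(** Only the thresholds [harmonic n] matter for a decreasing predicate [P].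
    Taking [r] among them and [0] determines [r] uniquely, which is what later
    allows two distances to be compared through their thresholds alone. *)
Lemma harmonic_threshold (R : realType) (P : nat -> Prop) :
  (forall n, P n.+1 -> P n) ->
  exists r : R, (r = 0 \/ exists k, r = harmonic k) /\
    forall n, r < harmonic n <-> P n.
Proof.
move=> Pdec; have [Pall|/existsNP exNP] := pselect (forall n, P n).
  by exists 0; split; [left | move=> n; split=> // _; exact: harmonic_gt0].
have exNPb : exists n, ~~ `[< P n >].
  by case: exNP => n nPn; exists n; apply/asboolPn.
case: (ex_minnP exNPb) => k /asboolPn nPk kmin.
exists (harmonic k); split; first by right; exists k.
move=> n; rewrite harmonic_lt; split=> [nk|Pn].
  by apply: contrapT => /asboolPn /kmin; rewrite leqNgt nk.
rewrite ltnNge; apply/negP => kn; apply: nPk.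
elim: n kn Pn => [|n IH]; first by rewrite leqn0 => /eqP->.
by rewrite leq_eqVlt => /orP[/eqP->//|/IH + /Pdec]; auto.
Qed.

(** The distance is read off the relations by [harmonic_threshold]; since its
    nonzero values are of the form [harmonic k], a failure of an inequality
    between distances is detected by [E k] for some [k]. *)
Lemma ultrametrizable_of_nested_equivalences (R : realType)
    (X : topologicalType) (E : nat -> X -> X -> Prop) :
  (forall n x y, E n.+1 x y -> E n x y) ->
  (forall x y, (forall n, E n x y) <-> x = y) ->
  (forall n x y, E n x y -> E n y x) ->
  (forall n x y z, E n x y -> E n y z -> E n x z) ->
  (forall n x, open (E n x)) ->
  (forall x A, open A -> A x -> exists n, E n x `<=` A) ->
  ultrametrizable R X.
Proof.
move=> Enest Ediag Esym Etrans Eopen Ebase.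
have /choice[d dP] (p : X * X) :=
  harmonic_threshold R _ (fun n => Enest n p.1 p.2).
have dE x y n : d (x, y) < harmonic n <-> E n x y by case: (dP (x, y)).
have d_ge0 x y : 0 <= d (x, y).
  by case: (dP (x, y)) => -[->//|[k ->]] _; exact: harmonic_ge0.
(* A positive distance is a threshold, at which the corresponding relation fails. *)
have d_le x y r : (forall k, r < harmonic k -> E k x y) -> 0 <= r -> d (x, y) <= r.
  move=> rE r0; rewrite leNgt; apply/negP => rd.
  case: (dP (x, y)) => -[d0|[k dk]] _; first by rewrite d0 ltNge r0 in rd.
  by have := rd; rewrite dk => /rE/dE; rewrite dk ltxx.
have dsym x y : d (x, y) = d (y, x).
  by apply/eqP; rewrite eq_le; apply/andP; split; apply: d_le => // k /dE/Esym.
have dultra x y z : d (x, z) <= Num.max (d (x, y)) (d (y, z)).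
  apply: d_le => [k|]; last by rewrite le_max d_ge0.
  by rewrite gt_max => /andP[/dE Exy /dE]; exact: Etrans.
exists (fun x y => d (x, y)); split => //; first split => //.
- move=> x y; split=> [d0|/Ediag Exy].
    by apply/Ediag => n; apply/dE; rewrite d0; exact: harmonic_gt0.
  by apply/eqP; rewrite eq_le d_ge0 andbT; apply: d_le.
- move=> x y z; apply: le_trans (dultra x y z) _.
  by rewrite ge_max lerDl lerDr !d_ge0.
- move=> A; split=> [Aop x Ax|Aball].
    have [n EA] := Ebase _ _ Aop Ax; exists (harmonic n); first exact: harmonic_gt0.
    by move=> y /dE/EA.
  rewrite openE => x /Aball[e /exists_harmonic_lt[n ne] eA].
  rewrite /interior nbhsE; exists (E n x); first by split; [exact: Eopen | exact: (proj2 (Ediag x x) erefl)].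
  by move=> y /dE dn; apply: eA; exact: lt_trans ne.
Qed.

(** * Strictly increasing closed covers *)

Lemma cover_subset {Y : topologicalType} {B : nat -> set Y} (m n : nat) :
  strictly_increasing_closed_cover B -> (m <= n)%N -> B m `<=` B n.
Proof.
case=> _ _ _ Blt; elim: n => [|n IH]; first by rewrite leqn0 => /eqP->.
rewrite leq_eqVlt => /orP[/eqP->//|/IH mn].
by apply: subset_trans mn _; case: (Blt n).
Qed.

Lemma cover_proper {Y : topologicalType} {B : nat -> set Y} (n : nat) :
  strictly_increasing_closed_cover B -> ~ ([set: Y] `<=` B n).
Proof.
by case=> _ _ _ Blt YB; case: (Blt n) => _; apply => y _; exact: YB.
Qed.

Lemma meets_complement (T : Type) (A C : set T) :
  (A `&` ~` C !=set0) <-> ~ (A `<=` C).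
Proof.
by split=> [[t [At Ct] /(_ t At)]|/nonsubset].
Qed.

Lemma bigcap_lower_inverse {X Y : Type} (psi : X -> set Y) (B : nat -> set Y) x :
  (\bigcap_n lower_inverse psi (~` B n)) x <-> forall n, ~ (psi x `<=` B n).
Proof.
by split=> [H n|H n _]; apply/meets_complement; [exact: (H n) | exact: H].
Qed.

(** * Set-valued maps from an ultrametric *)

(** Adding [B 0] keeps the value nonempty for points far from [F], and for
    empty [F]. *)
Definition thickening {R : realType} {X Y : Type} (d : X -> X -> R)
    (B : nat -> set Y) (F : set X) (x : X) : set Y :=
  [set t | B 0%N t \/ exists n, B n t /\ exists2 y, F y & d x y < harmonic n].

Section Thickening.
Context {R : realType} {X Y : topologicalType} {B : nat -> set Y}.
Context (Bcover : strictly_increasing_closed_cover B).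
Context {d : X -> X -> R}.
Context (d_metric : is_metric d) (d_top : induces_topology d).

Lemma thickening_in F x : F x -> thickening d B F x = setT.
Proof.
case: d_metric => _ d0 _ _ Fx; apply/seteqP; split=> // t.
case: Bcover => _ -> _ _ [n _ Bnt]; right; exists n; split=> //; exists x => //.
by rewrite (proj2 (d0 _ _) erefl); exact: harmonic_gt0.
Qed.

(** Since [F] is closed, [x] keeps a positive distance from it, so only
    finitely many [B n] contribute and the largest of them is the value. *)
Lemma thickening_notin F x : closed F -> ~ F x ->
  exists n, thickening d B F x = B n.
Proof.
move=> Fcl nFx.
have [e e0 eF] := proj1 (d_top _) (closed_openC Fcl) x nFx.
have [N Ne] := exists_harmonic_lt _ _ e0.
pose P n := `[< n = 0%N \/ exists2 y, F y & d x y < harmonic n >].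
have PN n : P n -> (n <= N)%N.
  move=> /asboolP[->//|[y Fy dn]]; rewrite leqNgt; apply/negP => Nn.
  apply: (eF y) => //=; apply: lt_trans dn (lt_trans _ Ne).
  by rewrite harmonic_lt.
have exP : exists n, P n by exists 0%N; apply/asboolP; left.
case: (ex_maxnP exP PN) => M /asboolP PM Mmax; exists M.
apply/seteqP; split=> t.
  case=> [|[n [Bnt Fn]]]; first by apply: cover_subset.
  by apply: cover_subset Bnt => //; apply: Mmax; apply/asboolP; right.
by case: PM => [->|Fn] Bt; [left | right; exists M].
Qed.

Lemma open_neighbourhood F (r : R) : open [set x | exists2 y, F y & d x y < r].
Proof.
case: d_metric => _ _ dsym dtri.
apply/d_top => x [y Fy dxy]; exists (r - d x y); first by rewrite subr_gt0.
move=> z /= dxz; exists y => //; apply: le_lt_trans (dtri z x y) _.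
by rewrite dsym -ltrBrDr.
Qed.

(** The value meets an open [V] at every point if [B 0] does; otherwise it does so
    on the union of those neighbourhoods of [F] whose [B n] meets [V]. *)
Lemma thickening_lsc F : closed F -> lsc_maps (thickening d B F).
Proof.
move=> Fcl; split.
  move=> x _; split; last by case: Bcover => _ _ [t Bt] _; exists t; left.
  have [Fx|nFx] := pselect (F x); first by rewrite thickening_in//; exact: closedT.
  by have [n ->] := thickening_notin _ _ Fcl nFx; case: Bcover.
move=> V _.
have [[t [B0t Vt]]|nB0V] := pselect (B 0%N `&` V !=set0).
  rewrite (_ : lower_inverse _ _ = setT); first exact: openT.
  by apply/seteqP; split=> // x _; exists t; split=> //; left.
rewrite (_ : lower_inverse _ _ =
  \bigcup_(n in [set n | B n `&` V !=set0])
    [set x | exists2 y, F y & d x y < harmonic n]).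
  by apply: bigcup_open => n _; exact: open_neighbourhood.
apply/seteqP; split=> x.
  move=> [t [[B0t|[n [Bnt Fn]]] Vt]]; first by case: nB0V; exists t.
  by exists n => //; exists t.
by move=> [n [t [Bnt Vt]] Fn]; exists t; split=> //; right; exists n.
Qed.

Lemma thickening_unbounded F : closed F ->
  F = \bigcap_n lower_inverse (thickening d B F) (~` B n).
Proof.
move=> Fcl; apply/seteqP; split=> x.
  move=> Fx; apply/bigcap_lower_inverse => n.
  by rewrite thickening_in//; exact: cover_proper.
move=> /bigcap_lower_inverse xn; apply: contrapT => nFx.
by have [n tn] := thickening_notin _ _ Fcl nFx; apply: (xn n); rewrite tn.
Qed.

Lemma thickening_mono F1 F2 x : F1 `<=` F2 ->
  thickening d B F1 x `<=` thickening d B F2 x.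
Proof.
move=> F12 t [?|[n [Bnt [y /F12 F2y dn]]]]; first by left.
by right; exists n; split=> //; exists y.
Qed.

Lemma thickening1_anti x y u v : d v u <= d y x ->
  thickening d B [set x] y `<=` thickening d B [set u] v.
Proof.
move=> uvxy t [?|[n [Bnt [_ -> dn]]]]; first by left.
by right; exists n; split=> //; exists u => //; exact: le_lt_trans dn.
Qed.

End Thickening.

(** * The equivalence *)

(* A map with domain a family D of subsets of X is a function on [set X] whose
   values outside D are irrelevant; [set_fun D L phi] says it maps D into L. *)
Theorem theorem4p4 (R : realType) (X Y : topologicalType) (B : nat -> set Y)
    (hX : hausdorff_space X) (hY : hausdorff_space Y)
    (hB : strictly_increasing_closed_cover B) :
  [<-> (* (a) *)
       ultrametrizable R X;
       (* (b) *)
       exists phi : set X -> X -> set Y,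
         [/\ set_fun (@closed_sets X) (@lsc_maps X Y) phi,
             forall F, closed_sets F ->
               F = \bigcap_n lower_inverse (phi F) (~` B n),
             forall F1 F2, closed_sets F1 -> closed_sets F2 -> F1 `<=` F2 ->
               forall x, phi F1 x `<=` phi F2 x,
             forall x y, phi [set x] y = phi [set y] x &
             forall x y z, phi [set x] y `<=` phi [set x] z \/
                           phi [set y] z `<=` phi [set x] z];
       (* (c) *)
       exists phi : set X -> X -> set Y,
         [/\ set_fun (@singleton_sets X) (@lsc_maps X Y) phi,
             forall x, [set x] = \bigcap_n lower_inverse (phi [set x]) (~` B n),
             forall x F, closed_sets F -> ~ F x -> bounded_wrt B (phi [set x]) F,
             forall x y, phi [set x] y = phi [set y] x &
             forall x y z, phi [set x] y `<=` phi [set x] z \/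
                           phi [set y] z `<=` phi [set x] z]].
Proof.
have closed1 (x : X) : closed [set x].
  by apply: accessible_closed_set1; exact: hausdorff_accessible.
tfae.
- move=> [d [dmet dtop dultra]]; have [_ _ dsym _] := dmet.
  exists (thickening d B); split.
  + by move=> F; exact: thickening_lsc.
  + by move=> F; exact: thickening_unbounded.
  + by move=> F1 F2 _ _ F12 x; exact: thickening_mono.
  + by move=> x y; apply/seteqP; split; apply: thickening1_anti; rewrite dsym.
  + move=> x y z; have := dultra x y z; rewrite le_max => /orP[xzxy|xzyz].
      by left; apply: thickening1_anti; rewrite dsym (dsym y).
    by right; apply: thickening1_anti; rewrite dsym (dsym z y).
- move=> [phi [phi_lsc phi_unb phi_mono phi_sym phi_ultra]].
  exists phi; split=> //.
  + by move=> _ [x _ <-]; apply: phi_lsc; exact: closed1.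
  + by move=> x; apply: phi_unb; exact: closed1.
  + move=> x F Fcl; rewrite {1}(phi_unb _ Fcl) => nFx.
    have /existsNP[n /contrapT Fn] : ~ forall n, ~ (phi F x `<=` B n).
      by move=> /bigcap_lower_inverse.
    exists n => y Fy; rewrite /upper_inverse /= phi_sym.
    by apply: subset_trans Fn; apply: phi_mono => [| |_ ->]; [exact: closed1 | exact: Fcl | exact: Fy].
- move=> [phi [phi_lsc phi_unb phi_bnd phi_sym phi_ultra]].
  pose E n x y := ~ (phi [set x] y `<=` B n).
  apply: (@ultrametrizable_of_nested_equivalences R X E).
  + move=> n x y; apply: contra_not => xyn; apply: subset_trans xyn _.
    exact: cover_subset.
  + move=> x y; rewrite -bigcap_lower_inverse -phi_unb.
    split=> [xy|->]; [ | by []]; exact: esym xy.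
  + by move=> n x y; rewrite /E phi_sym.
  + move=> n x y z Exy Eyz xzn.
    by case: (phi_ultra x y z) => sub; [apply: Exy | apply: Eyz];
      apply: subset_trans xzn.
  + move=> n x.
    rewrite (_ : E n x = lower_inverse (phi [set x]) (~` B n)).
      have [_] : lsc_maps (phi [set x]) by apply: phi_lsc; exists x.
      by apply; apply: closed_openC; case: hB.
    by apply/funext => y; apply/propext; rewrite /E -meets_complement.
  + move=> x A Aop Ax.
    have [] := phi_bnd x (~` A); [exact: open_closedC | by apply |].
    move=> n bn; exists n => y Exy; apply: contrapT => nAy.
    by apply: Exy; exact: bn.
Qed.
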